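(* Let $\sigma>0$, let $f:\mathbb{R}\to\mathbb{C}$ be the characteristic function of a probability density $\varphi$, and let $g:\mathbb{R}\to\mathbb{C}$ be a characteristic function. If $f(t)=g(t)$ for all $t\in U_\sigma$ and $$|S_\varphi|<\frac{2\pi}{\sigma},$$ then $f(t)=g(t)$ for all $t\in\mathbb{R}$.
   Context: A characteristic function is the Fourier transform $\hat\mu(t)=\int_{\mathbb{R}}e^{-itx}\,d\mu(x)$, $t\in\mathbb{R}$, of a probability measure $\mu$ (Borel, on $\mathbb{R}$). A probability density is a function $\varphi\in L^1(\mathbb{R})$ with $\varphi\ge 0$ almost everywhere and $\|\varphi\|_{L^1(\mathbb{R})}=1$; its characteristic function is $\hat\varphi(t)=\int_{\mathbb{R}}e^{-itx}\varphi(x)\,dx$. For $\sigma>0$, $U_\sigma=\{x\in\mathbb{R}:|x|>\sigma\}$. For a measurable $\varphi:\mathbb{R}\to\mathbb{R}$, the essential support $S_\varphi$ is the set of all $x\in\mathbb{R}$ such that for every $\varepsilon>0$ the set $(x-\varepsilon,x+\varepsilon)\cap\{t\in\mathbb{R}:|\varphi(t)|>0\}$ has positive Lebesgue measure. $|S_\varphi|$ denotes the Lebesgue measure of $S_\varphi$. *)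

(* Defs.v *)
From mathcomp Require Import all_boot all_order all_algebra.
From mathcomp Require Import all_classical all_reals all_analysis.
From mathcomp Require Export complex.

Set Implicit Arguments.
Unset Strict Implicit.
Unset Printing Implicit Defensive.
Import Order.TTheory GRing.Theory Num.Theory.
Import numFieldNormedType.Exports.

Local Open Scope classical_set_scope.
Local Open Scope ring_scope.

Definition Cexpi (R : realType) (y : R) : R[i] := (cos y +i* sin y)%C.

Definition Cintegral d (T : measurableType d) (R : realType)
    (mu : {measure set T -> \bar R}) (F : T -> R[i]) : R[i] :=
  ((\int[mu]_x complex.Re (F x)) +i* (\int[mu]_x complex.Im (F x)))%C.

Definition fourier_prob (R : realType) (mu : probability (measurableTypeR R) R)
    (t : R) : R[i] :=
  Cintegral mu (fun x : measurableTypeR R => Cexpi (- (t * x))).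

Definition is_char_fun (R : realType) (g : R -> R[i]) : Prop :=
  exists mu : probability (measurableTypeR R) R, g =1 fourier_prob mu.

(* For functions on the line, "measurable" and "L^1" refer to the Lebesgue
   (completed) sigma-algebra, hence [completed_lebesgue_measure]; its carrier
   [caratheodory_type _] is convertible to [R]. *)
Definition is_density (R : realType) (phi : R -> R) : Prop :=
  [/\ phi \in Lfun (@completed_lebesgue_measure R) 1%E,
      {ae @completed_lebesgue_measure R, forall x, 0 <= phi x} &
      ('N[@completed_lebesgue_measure R]_1[EFin \o phi] = 1)%E].

Definition fourier (R : realType) (phi : R -> R) (t : R) : R[i] :=
  Cintegral (@completed_lebesgue_measure R)
    (fun x => Cexpi (- (t * x)) * ((phi x)%:C)%C).

Definition U_ (R : realType) (sigma : R) : set R := [set x | sigma < `|x|].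

Definition ess_support (R : realType) (phi : R -> R) : set R :=
  [set x | forall e : R, 0 < e ->
    (0%:E < @completed_lebesgue_measure R
              (`]x - e, x + e[ `&` [set t | 0 < `|phi t|])%R)%E].

(* Main.v *)
From HB Require Import structures.
Require Import Defs.
From mathcomp Require Import all_boot all_order all_algebra.
From mathcomp Require Import all_classical all_reals all_analysis.
From mathcomp Require Import measurable_realfun ring lra.
(** Let mu be the probability measure behind [g] and nu the signed measure
mu - phi dx. Its cosine and sine transforms C and S are continuous, vanish for
t >= sigma, and C(0) = 0 because mu and phi dx have the same mass. The function
<<
        H(x) = int_0^sigma (C(t) cos(tx) + S(t) sin(tx)) dt
>>
is, up to a constant, the density that Fourier inversion assigns to nu. The
theorem follows once H is known to vanish identically, since Fubini then gives
int_0^sigma (C^2 + S^2) = int H dnu = 0 ([transform_diff_eq0]). Three facts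
about H force this.

- H >= 0 off the essential support of phi ([trigint_off_support_ge0]). Near
  such a point nu is a nonnegative measure. Multiplying C and S by the triangle
  function 1 - t/A amounts to integrating nu against a Fejer kernel in x, which
  is nonnegative and O(1/A) away from its centre; so H is bounded below by
  O(1/A), and A is arbitrary.

- If H >= 0 on the lattice x + pZ, with p = 2 pi / sigma, then H(x) = 0
  ([trigint_lattice_ge0]). This is Poisson summation in a weak form: the Cesaro
  means of the sum of H over the lattice are the integrals of the transform of
  nu against a Fejer kernel in t of period sigma. The kernel concentrates at 0
  and sigma, where the transform vanishes, so that the means tend to 0, while
  each of them is at least H(x).

- H is the restriction of an entire function, so it vanishes identically as
  soon as its zeros accumulate ([trigint_identity]).

It remains to see that the second fact applies often enough. Modulo p the
essential support covers a set of measure at most |S_phi| < p, so that a set of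
positive measure of points x with 0 <= x < p has its whole lattice x + pZ off
the essential support ([lattice_avoiding_infinite]); H vanishes on that bounded
infinite set.

Real transforms on [0, sigma] carry all the information because the transform
of nu is Hermitian. Replacing phi by |phi|, which changes no integral, makes
both weights nonnegative everywhere. *)

Set Implicit Arguments.
Unset Strict Implicit.
Unset Printing Implicit Defensive.
Import Order.TTheory GRing.Theory Num.Theory.
Import numFieldNormedType.Exports.

Local Open Scope classical_set_scope.
Local Open Scope ring_scope.

(** * The Fejer kernel *)

Section fejer_kernel.
Variable R : realType.
Implicit Types (N : nat) (x a : R).

Definition sumcos N x : R := \sum_(j < N) cos (j%:R * x).
Definition sumsin N x : R := \sum_(j < N) sin (j%:R * x).

(** This is |1 + e^(ix) + ... + e^(i(N-1)x)|^2, without the usual factor 1/N. *)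
Definition fejer N x : R := sumcos N x ^+ 2 + sumsin N x ^+ 2.

Lemma fejer_ge0 N x : 0 <= fejer N x.
Proof. by rewrite addr_ge0// sqr_ge0. Qed.

(** Multiplying by sin(x/2) telescopes the sum. *)
Lemma sin_half_sumcos N x :
  sin (x / 2) * sumcos N x = (sin (N%:R * x - x / 2) + sin (x / 2)) / 2.
Proof.
rewrite /sumcos; elim: N => [|N IH].
  by rewrite big_ord0 mul0r sub0r sinN addNr mul0r mulr0.
rewrite big_ord_recr /= mulrDr IH.
have -> : N.+1%:R * x - x / 2 = N%:R * x + x / 2.
  by rewrite -natr1; lra.
by rewrite !(sinD, cosN, sinN); lra.
Qed.

Lemma sin_half_sumsin N x :
  sin (x / 2) * sumsin N x = (cos (x / 2) - cos (N%:R * x - x / 2)) / 2.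
Proof.
rewrite /sumsin; elim: N => [|N IH].
  by rewrite big_ord0 mul0r sub0r cosN subrr mul0r mulr0.
rewrite big_ord_recr /= mulrDr IH.
have -> : N.+1%:R * x - x / 2 = N%:R * x + x / 2.
  by rewrite -natr1; lra.
by rewrite !(cosD, cosN, sinN); lra.
Qed.

(** Away from the multiples of 2 pi the kernel stays bounded as N grows, while its
mean over a period is N: this is what makes it concentrate. *)
Lemma sin_half_fejer_le N x : sin (x / 2) ^+ 2 * fejer N x <= 2.
Proof.
have half a b : `|a| <= 1 -> `|b| <= 1 -> ((a + b) / 2) ^+ 2 <= 1 :> R.
  by rewrite !ler_norml => /andP[? ?] /andP[? ?]; nra.
rewrite /fejer mulrDr -!exprMn sin_half_sumcos sin_half_sumsin.
rewrite (_ : 2 = 1 + 1)//; apply: lerD; apply: half.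
- exact: sin_max.
- exact: sin_max.
- exact: cos_max.
- by rewrite normrN cos_max.
Qed.

(** The frequencies j - l cancel in pairs, so the kernel factors out of the sum of
a sinusoid over shifted phases; this turns a double sum over lattice translates
into one integral against the kernel. *)
Lemma sum_cos_shift N x a :
  \sum_(j < N) \sum_(l < N) cos (a + (j%:R - l%:R) * x) = cos a * fejer N x.
Proof.
rewrite /fejer !expr2 /sumcos /sumsin !big_distrlr/= mulrDr !mulr_sumr.
have h : \sum_(j < N) \sum_(l < N)
   (sin (j%:R * x) * cos (l%:R * x) - cos (j%:R * x) * sin (l%:R * x)) = 0.
  under eq_bigr do rewrite sumrB.
  rewrite sumrB [X in _ - X]exchange_big/= -sumrB big1// => j _.
  by rewrite -sumrB big1// => l _; ring.
transitivity (\sum_(j < N) \sum_(l < N)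
   (cos a * (cos (j%:R * x) * cos (l%:R * x)) +
    cos a * (sin (j%:R * x) * sin (l%:R * x))) -
   sin a * \sum_(j < N) \sum_(l < N)
   (sin (j%:R * x) * cos (l%:R * x) - cos (j%:R * x) * sin (l%:R * x))).
  rewrite mulr_sumr -sumrB; apply: eq_bigr => j _.
  rewrite mulr_sumr -sumrB; apply: eq_bigr => l _.
  by rewrite mulrBl cosD cosB sinB; ring.
rewrite h mulr0 subr0 -big_split/=; apply: eq_bigr => j _.
by rewrite !mulr_sumr -big_split.
Qed.

Lemma sum_sin_shift N x a :
  \sum_(j < N) \sum_(l < N) sin (a + (j%:R - l%:R) * x) = sin a * fejer N x.
Proof.
rewrite -cosBpihalf -sum_cos_shift.
apply: eq_bigr => j _; apply: eq_bigr => l _.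
by rewrite -cosBpihalf; congr cos; ring.
Qed.

End fejer_kernel.

(** * Integrals of continuous functions over [0, a] *)

Section continuous_integral.
Variable R : realType.
Implicit Types (f g F : R -> R) (a c x y : R).

Lemma continuous_addf f g : continuous f -> continuous g ->
  continuous (fun t => f t + g t).
Proof. by move=> cf cg t; apply: cvgD; [exact: cf|exact: cg]. Qed.

Lemma continuous_mulf f g : continuous f -> continuous g ->
  continuous (fun t => f t * g t).
Proof. by move=> cf cg t; apply: cvgM; [exact: cf|exact: cg]. Qed.

Lemma continuous_cst c : continuous (fun _ : R => c).
Proof. by move=> t; exact: cvg_cst. Qed.

Lemma continuous_idf : continuous (fun t : R => t).
Proof. by move=> t; exact: cvg_id. Qed.

Lemma continuous_oppf f : continuous f -> continuous (fun t => - f t).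
Proof. by move=> cf t; apply: cvgN; exact: cf. Qed.

Lemma continuous_cosf f : continuous f -> continuous (fun t => cos (f t)).
Proof.
by move=> cf t; apply: continuous_comp; [exact: cf|exact: continuous_cos].
Qed.

Lemma continuous_sinf f : continuous f -> continuous (fun t => sin (f t)).
Proof.
by move=> cf t; apply: continuous_comp; [exact: cf|exact: continuous_sin].
Qed.

Lemma continuous_normf f : continuous f -> continuous (fun t => `|f t|).
Proof. by move=> cf t; apply: cvg_norm; exact: cf. Qed.

Lemma continuous_sumf (I : Type) (s : seq I) (f : I -> R -> R) :
  (forall i, continuous (f i)) -> continuous (fun t => \sum_(i <- s) f i t).
Proof.
move=> cf; elim: s => [|i s IH].
  rewrite (_ : (fun _ => _) = (fun=> 0)); first exact: continuous_cst.
  by apply/funext => t; rewrite big_nil.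
rewrite (_ : (fun _ => _) = (fun t => f i t + \sum_(i <- s) f i t)).
  exact: continuous_addf.
by apply/funext => t; rewrite big_cons.
Qed.

Definition int0 a f : R := \int[lebesgue_measure]_(t in `[0, a]) f t.

Lemma integrable0 a f : continuous f ->
  lebesgue_measure.-integrable `[0, a] (EFin \o f).
Proof.
move=> cf; apply: continuous_compact_integrable; first exact: segment_compact.
exact: continuous_subspaceT.
Qed.

Lemma eq_int0 a f g : (forall t, 0 <= t <= a -> f t = g t) ->
  int0 a f = int0 a g.
Proof.
move=> fg; apply: eq_Rintegral => t; rewrite inE/= in_itv/=; exact: fg.
Qed.

Lemma int0D a f g : continuous f -> continuous g ->
  int0 a (fun t => f t + g t) = int0 a f + int0 a g.
Proof. by move=> cf cg; apply: RintegralD => //; exact: integrable0. Qed.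

Lemma int0B a f g : continuous f -> continuous g ->
  int0 a (fun t => f t - g t) = int0 a f - int0 a g.
Proof. by move=> cf cg; apply: RintegralB => //; exact: integrable0. Qed.

Lemma int0Z a c f : continuous f -> int0 a (fun t => c * f t) = c * int0 a f.
Proof. by move=> cf; apply: RintegralZl => //; exact: integrable0. Qed.

Lemma int0_sum a (I : Type) (s : seq I) (f : I -> R -> R) :
  (forall i, continuous (f i)) ->
  int0 a (fun t => \sum_(i <- s) f i t) = \sum_(i <- s) int0 a (f i).
Proof.
move=> cf; elim: s => [|i s IH].
  rewrite big_nil /int0; under eq_Rintegral do rewrite big_nil.
  by rewrite Rintegral_cst ?mul0r//; exact: measurable_itv.
rewrite big_cons -IH -int0D//; last exact: continuous_sumf.
by apply: eq_int0 => t _; rewrite big_cons.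
Qed.

Lemma int0_cst a c : 0 <= a -> int0 a (fun=> c) = c * a.
Proof.
move=> a0; rewrite /int0 Rintegral_cst; last exact: measurable_itv.
congr (_ * _); have := @lebesgue_measure_itv R `[0, a].
rewrite /= lte_fin; case: ltP => [_ ->|a0' ->]; first by rewrite /= subr0.
by apply/eqP; rewrite eq_le a0' /= andbT.
Qed.

Lemma le_int0 a f g : continuous f -> continuous g ->
  (forall t, 0 <= t <= a -> f t <= g t) -> int0 a f <= int0 a g.
Proof.
move=> cf cg fg; apply: le_Rintegral; [by []|exact: integrable0..|].
by move=> t; rewrite /= in_itv/=; exact: fg.
Qed.

Lemma int0_ge0 a f : (forall t, 0 <= t <= a -> 0 <= f t) -> 0 <= int0 a f.
Proof.
by move=> f0; apply: Rintegral_ge0 => t; rewrite /= in_itv/=; exact: f0.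
Qed.

Lemma int0_norm_le a f g : continuous f -> continuous g ->
  (forall t, 0 <= t <= a -> `|f t| <= g t) -> `|int0 a f| <= int0 a g.
Proof.
move=> cf cg fg.
have fg' t : 0 <= t <= a -> - g t <= f t <= g t.
  by move=> /fg; rewrite ler_norml.
rewrite ler_norml; apply/andP; split.
  have -> : - int0 a g = int0 a (fun t => -1 * g t) by rewrite int0Z// mulN1r.
  apply: le_int0 => //.
    by apply: continuous_mulf => //; exact: continuous_cst.
  by move=> t /fg' /andP[? _]; rewrite mulN1r.
by apply: le_int0 => // t /fg' /andP[].
Qed.

Lemma int0_FTC a f F : 0 < a -> continuous f ->
  (forall t : R, is_derive t 1 F (f t)) -> int0 a f = F a - F 0.
Proof.
move=> a0 cf dF.
have cF : continuous F.
  by move=> t; apply/differentiable_continuous/derivable1_diffP; case: (dF t).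
rewrite /int0 /Rintegral (@continuous_FTC2 _ f F)//.
- exact: continuous_subspaceT.
- split; first by move=> t _; case: (dF t).
  + exact/cvg_at_right_filter/cF.
  + exact/cvg_at_left_filter/cF.
- by move=> t _; rewrite derive1E; apply: derive_val.
Qed.

Lemma integral_indic0 (A : R) (g : R -> R) : continuous g ->
  (\int[lebesgue_measure]_t ((\1_(`[0%R, A]%classic) t * g t)%:E) =
   (int0 A g)%:E)%E.
Proof.
move=> cg; rewrite /int0 fineK; last first.
  by apply: integrable_fin_num => //; exact: integrable0.
rewrite [RHS]integral_mkcond; apply: eq_integral => t _.
by rewrite patchE indicE; case: ifPn => _; rewrite ?mul1r ?mul0r.
Qed.

End continuous_integral.

Ltac cont := repeat lazymatch goal with
  | |- forall i, continuous _ => move=> ?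
  | |- continuous (fun t => @?f t + @?g t) => apply: (@continuous_addf _ f g)
  | |- continuous (fun t => @?f t * @?g t) => apply: (@continuous_mulf _ f g)
  | |- continuous (fun t => - @?f t) => apply: (@continuous_oppf _ f)
  | |- continuous (fun t => cos (@?f t)) => apply: (@continuous_cosf _ f)
  | |- continuous (fun t => sin (@?f t)) => apply: (@continuous_sinf _ f)
  | |- continuous (fun t => `|@?f t|) => apply: (@continuous_normf _ f)
  | |- continuous (fun t => \sum_(i <- _) @?f t i) => apply: continuous_sumf
  | |- continuous _ =>
    first [assumption | exact: continuous_idf | exact: continuous_cst]
  end.

Section fejer_integral.
Variable R : realType.
Implicit Types (a c x y : R).

Lemma continuous_fejer N c : continuous (fun t : R => fejer N (c * t)).
Proof.
rewrite (_ : (fun _ => _) = fun t : R =>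
  sumcos N (c * t) * sumcos N (c * t) + sumsin N (c * t) * sumsin N (c * t)).
  by rewrite /sumcos /sumsin; cont.
by apply/funext => t; rewrite /fejer !expr2.
Qed.

Lemma sin_nat2pi n : sin (n%:R * (2 * pi)) = 0 :> R.
Proof.
elim: n => [|n IH]; first by rewrite mul0r sin0.
by rewrite -natr1 mulrDl mul1r [X in _ + X](mulr_natl pi 2) sinD2pi.
Qed.

(** Only the N diagonal terms of the double sum have a nonzero mean over the
period [sigma] of [fun t => fejer N (2 * pi / sigma * t)]. *)
Lemma int0_fejer (sigma : R) N : 0 < sigma ->
  int0 sigma (fun t => fejer N (2 * pi / sigma * t)) = N%:R * sigma :> R.
Proof.
move=> s0; set p := 2 * pi / sigma.
have p0 : 0 < p by rewrite divr_gt0// mulr_gt0// pi_gt0.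
have -> : int0 sigma (fun t => fejer N (p * t)) =
  int0 sigma (fun t => \sum_(j < N) \sum_(l < N) cos ((j%:R - l%:R) * (p * t))).
  apply: eq_int0 => t _.
  have := sum_cos_shift N (p * t) 0; rewrite cos0 mul1r => <-.
  by apply: eq_bigr => j _; apply: eq_bigr => l _; rewrite add0r.
rewrite int0_sum; last by cont.
transitivity (\sum_(j < N) sigma); last first.
  by rewrite sumr_const card_ord mulr_natl.
apply: eq_bigr => j _; rewrite int0_sum; last by cont.
rewrite (bigD1 j)//= subrr [X in X + _](_ : _ = sigma); last first.
  transitivity (int0 sigma (fun=> 1 : R)).
    by apply: eq_int0 => t _; rewrite mul0r cos0.
  by rewrite int0_cst ?mul1r// ltW.
rewrite big1 ?addr0// => l lj.
have jl0 : (j%:R - l%:R : R) != 0.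
  by rewrite subr_eq0 eqr_nat; apply: contra lj => /eqP lj; apply/eqP/val_inj.
set k := (j%:R - l%:R : R); have kp0 : k * p != 0 by rewrite mulf_neq0// gt_eqF.
have dF (t : R) : is_derive t 1 (fun t : R => (k * p)^-1 * sin (k * p * t))
    (cos (k * (p * t))).
  apply: is_derive_eq; rewrite /GRing.scale/= mulrA.
  by field; rewrite gt_eqF// jl0.
rewrite (int0_FTC s0 _ dF); last by cont.
have -> : k * p * sigma = j%:R * (2 * pi) - l%:R * (2 * pi).
  by rewrite /k /p; field; rewrite gt_eqF.
rewrite sinD sinN cosN !sin_nat2pi mulr0 sin0 mul0r oppr0 mulr0 addr0.
by rewrite mulr0 subrr.
Qed.

(** The transform of the triangle function is a Fejer kernel. Its sign and its
decay in [y] follow from the closed form. *)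
Lemma int0_triangleE (A y : R) : 0 < A -> y != 0 ->
  int0 A (fun t => (1 - t / A) * cos (t * y)) =
  (1 - cos (A * y)) / (A * y ^+ 2).
Proof.
move=> A0 y0.
have dF (t : R) : is_derive t 1
   (fun t : R => (1 - A^-1 * t) * (y^-1 * sin (y * t)) -
     (A * y ^+ 2)^-1 * cos (y * t)) ((1 - t / A) * cos (t * y)).
  apply: is_derive_eq; rewrite /GRing.scale/= [t * y]mulrC.
  by field; rewrite gt_eqF.
rewrite (int0_FTC A0 _ dF); last by cont.
rewrite mulVf ?gt_eqF// subrr !mul0r !mulr0 sin0 !mulr0 cos0 [y * A]mulrC.
by field; rewrite y0 gt_eqF.
Qed.

Lemma int0_triangle_le (A y : R) : 0 < A -> y != 0 ->
  int0 A (fun t => (1 - t / A) * cos (t * y)) <= 2 / (A * y ^+ 2).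
Proof.
move=> A0 y0; rewrite int0_triangleE// ler_pM2r.
  by have := @cos_geN1 R (A * y); lra.
by rewrite invr_gt0 mulr_gt0// exprn_even_gt0.
Qed.

Lemma int0_triangle_ge0 (A y : R) : 0 < A ->
  0 <= int0 A (fun t => (1 - t / A) * cos (t * y)).
Proof.
move=> A0; have [->|y0] := eqVneq y 0.
  apply: int0_ge0 => t /andP[t0 tA]; rewrite mulr0 cos0 mulr1 subr_ge0.
  by rewrite ler_pdivrMr// mul1r.
rewrite int0_triangleE// divr_ge0 ?subr_ge0 ?cos_le1//.
by rewrite mulr_ge0 ?sqr_ge0 ?ltW.
Qed.

End fejer_integral.

(** * Nonnegativity on a lattice forces vanishing *)

Section lattice_positivity.
Variable R : realType.
Implicit Types (C S G : R -> R) (sigma x : R).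

(** On [0, sigma] the kernel is large only near 0 and sigma, where [G] is small.
The bound is relative to N, the order of the total mass of the kernel. *)
Lemma fejer_concentration sigma G : 0 < sigma -> continuous G ->
  G 0 = 0 -> G sigma = 0 -> forall e : R, 0 < e ->
  exists2 N, (0 < N)%N &
    `|int0 sigma (fun t => G t * fejer N (2 * pi / sigma * t))| <= e * N%:R.
Proof.
move=> s0 cG G0 Gs e e0; set p := 2 * pi / sigma.
pose e' := e / (2 * sigma).
have e'0 : 0 < e' by rewrite divr_gt0// mulr_gt0.
have [d0 /= d0_gt0 Hd0] :
    exists2 d : R, 0 < d & forall t, `|t| < d -> `|G t| < e'.
  have /cvgrPdist_lt/(_ _ e'0) [d /= d0 Hd] := cG 0.
  exists d => // t td; have := Hd t; rewrite /ball_/= sub0r normrN => /(_ td).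
  by rewrite G0 sub0r normrN.
have [d1 /= d1_gt0 Hd1] :
    exists2 d : R, 0 < d & forall t, `|sigma - t| < d -> `|G t| < e'.
  have /cvgrPdist_lt/(_ _ e'0) [d /= d0' Hd] := cG sigma.
  exists d => // t td; have := Hd t; rewrite /ball_/= => /(_ td).
  by rewrite Gs sub0r normrN.
(* The cap sigma / 3 keeps the middle interval [d, sigma - d] nonempty. *)
pose d := Num.min (sigma / 3) (Num.min d0 d1).
have d_gt0 : 0 < d by rewrite !lt_min d0_gt0 d1_gt0 divr_gt0.
have d_s3 : d <= sigma / 3 by rewrite ge_min lexx.
have d_d0 : d <= d0 by rewrite !ge_min lexx !orbT.
have d_d1 : d <= d1 by rewrite !ge_min lexx !orbT.
have csin : continuous (fun t => sin (p * t / 2) * sin (p * t / 2)) by cont.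
have ds : d <= sigma - d by lra.
have [t0 t0d Ht0] := EVT_min ds (continuous_subspaceT csin).
pose c := sin (p * t0 / 2) * sin (p * t0 / 2).
have c_gt0 : 0 < c.
  rewrite /c -expr2 exprn_gt0// sin_gt0_pi//.
  move: t0d; rewrite in_itv/= => /andP[dt0 t0d].
  have -> : p * t0 / 2 = pi * (t0 / sigma) by rewrite /p; field; rewrite gt_eqF.
  have pi0 := pi_gt0 R.
  rewrite mulr_gt0//=; last by rewrite divr_gt0//; lra.
  by rewrite gtr_pMr// ltr_pdivrMr// mul1r; lra.
have [t1 _ Ht1] :=
  EVT_max (ltW s0) (continuous_subspaceT (continuous_normf cG)).
pose M : R := `|G t1|.
have M0 : 0 <= M by rewrite normr_ge0.
(* Either [t] is near an endpoint and the value of G is below e', or [t] lies in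
   [d, sigma - d], where sin_half_fejer_le bounds the kernel by 2 / c. *)
have key N (t : R) : 0 <= t <= sigma ->
    `|G t * fejer N (p * t)| <= e' * fejer N (p * t) + M * (2 / c).
  move=> t0s; have F0 := fejer_ge0 N (p * t).
  rewrite normrM (ger0_norm F0).
  have GM : `|G t| <= M by apply: Ht1; rewrite in_itv.
  have [Ge|Ge] := ltP `|G t| e'.
    rewrite (@le_trans _ _ (e' * fejer N (p * t)))//.
      by rewrite ler_wpM2r// ltW.
    by rewrite lerDl mulr_ge0// divr_ge0// ltW.
  rewrite (@le_trans _ _ (M * (2 / c)))//; last first.
    by rewrite lerDr mulr_ge0// ltW.
  rewrite ler_pM//.
  have td : t \in `[d, sigma - d].
    move: t0s => /andP[t_ge0 t_les]; rewrite in_itv/=; apply/andP; split.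
      rewrite leNgt; apply/negP => td; move: Ge; rewrite leNgt Hd0//.
      by rewrite ger0_norm// (lt_le_trans td).
    rewrite leNgt; apply/negP => td; move: Ge; rewrite leNgt Hd1//.
    by rewrite ger0_norm ?subr_ge0//; lra.
  rewrite ler_pdivlMr// mulrC.
  apply: (le_trans _ (sin_half_fejer_le N (p * t))).
  by rewrite expr2 ler_wpM2r// Ht0.
pose B : R := M * (2 / c) * sigma.
have B0 : 0 <= B by rewrite !mulr_ge0// ?invr_ge0 ltW.
have [N HN] : exists N : nat, B / (e / 2) < N.+1%:R.
  exists (Num.Def.truncn (B / (e / 2))); exact: truncnS_gt.
exists N.+1 => //; apply: (le_trans (int0_norm_le _ _ (key N.+1))).
- by apply: continuous_mulf => //; exact: continuous_fejer.
- apply: continuous_addf; last exact: continuous_cst.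
  by apply: continuous_mulf; [exact: continuous_cst|exact: continuous_fejer].
rewrite int0D; last 2 first.
- by apply: continuous_mulf; [exact: continuous_cst|exact: continuous_fejer].
- exact: continuous_cst.
rewrite int0Z; last exact: continuous_fejer.
rewrite int0_fejer// (int0_cst _ (ltW s0)) -/B.
have -> : e' * (N.+1%:R * sigma) = e / 2 * N.+1%:R.
  by rewrite /e'; field; rewrite gt_eqF.
move: HN; rewrite ltr_pdivrMr ?divr_gt0// => /ltW HN.
lra.
Qed.

(** When [C] and [S] are the cosine and sine transforms of a signed measure, cut
off at [sigma], this is pi times the density given by Fourier inversion. *)
Definition trigint sigma C S x :=
  int0 sigma (fun t => C t * cos (t * x) + S t * sin (t * x)).

(** A weak Poisson summation. Summing over the pairs (j, l) with j, l < N weights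
the lattice point x + kp by N - |k|, so the diagonal contributes N H(x) and the
other terms are nonnegative; the whole sum is an integral against the Fejer
kernel, hence o(N). *)
Lemma trigint_lattice_ge0 sigma C S x : 0 < sigma ->
  continuous C -> continuous S -> C 0 = 0 -> C sigma = 0 -> S sigma = 0 ->
  (forall j l : nat,
    0 <= trigint sigma C S (x + (j%:R - l%:R) * (2 * pi / sigma))) ->
  trigint sigma C S x = 0.
Proof.
move=> s0 cC cS C0 Cs Ss H0; set p := 2 * pi / sigma in H0 *.
apply/eqP; rewrite eq_le; apply/andP; split; last first.
  by have := H0 0%N 0%N; rewrite subrr mul0r addr0.
apply/ler_addgt0Pl => e e0; rewrite addr0.
pose G t := C t * cos (t * x) + S t * sin (t * x).
have cG : continuous G by rewrite /G; cont.
have [|| N N0 HN] := fejer_concentration s0 cG _ _ e0.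
- by rewrite /G C0 !mul0r sin0 mulr0 addr0.
- by rewrite /G Cs Ss !mul0r addr0.
rewrite -(ler_pM2r (_ : 0 < N%:R :> R)) ?ltr0n//.
apply: (le_trans _ (le_trans (ler_norm _) HN)).
have -> : int0 sigma (fun t => G t * fejer N (p * t)) =
    \sum_(j < N) \sum_(l < N) trigint sigma C S (x + (j%:R - l%:R) * p).
  under [RHS]eq_bigr => j _.
    rewrite /trigint -int0_sum; last by cont.
    over.
  rewrite -int0_sum; last by cont.
  apply: eq_int0 => t _.
  rewrite /G mulrDl -!mulrA -sum_cos_shift -sum_sin_shift.
  rewrite !mulr_sumr -big_split; apply: eq_bigr => j _ /=.
  rewrite !mulr_sumr -big_split; apply: eq_bigr => l _ /=.
  by congr (_ * cos _ + _ * sin _); rewrite /p; ring.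
rewrite (_ : _ * N%:R = \sum_(j < N) trigint sigma C S x); last first.
  by rewrite sumr_const card_ord mulr_natr.
apply: ler_sum => j _; rewrite (bigD1 j)//= subrr mul0r addr0 lerDl.
exact: sumr_ge0.
Qed.

End lattice_positivity.

(** * The identity theorem *)

Section identity_theorem.
Variable R : realType.

Lemma derive_global_MVT (f df : R -> R) (x0 x : R) :
  (forall y : R, is_derive y 1 f (df y)) ->
  exists2 c, `|c - x0| <= `|x - x0| & f x - f x0 = df c * (x - x0).
Proof.
move=> fdf.
have cf : continuous f.
  by move=> t; apply/differentiable_continuous/derivable1_diffP; case: (fdf t).
have [x0x|xx0] := leP x0 x.
  have [c cI ->] :=
    MVT_segment x0x (fun y _ => fdf y) (continuous_subspaceT cf).
  exists c => //; move: cI; rewrite in_itv/= => /andP[? ?].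
  by rewrite !ger0_norm ?subr_ge0// lerD2r.
have [c cI e] :=
  MVT_segment (ltW xx0) (fun y _ => fdf y) (continuous_subspaceT cf).
exists c; last by rewrite -opprB e -mulrN opprB.
move: cI; rewrite in_itv/= => /andP[xc cx0].
by rewrite distrC [leRHS]distrC !ger0_norm ?subr_ge0 ?(ltW xx0)// lerD2l lerN2.
Qed.

(** Rolle between the accumulation point and a nearby zero: the critical point is
strictly between them, hence distinct from the accumulation point. *)
Lemma limit_point_zeros_derive (f df : R -> R) (x0 : R) :
  (forall y : R, is_derive y 1 f (df y)) ->
  limit_point [set y | f y = 0] x0 ->
  f x0 = 0 /\ limit_point [set y | df y = 0] x0.
Proof.
move=> fdf lp.
have cf : continuous f.
  by move=> t; apply/differentiable_continuous/derivable1_diffP; case: (fdf t).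
have fx0 : f x0 = 0.
  apply/eqP; apply/negPn/negP => fx0.
  have fx0' : 0 < `|f x0| by rewrite normr_gt0.
  have /cvgrPdist_lt/(_ _ fx0')/lp [y [_ /= -> ]] := cf x0.
  by rewrite subr0 ltxx.
split => // U [e /= e0 eU].
have [|y [/= yx0 fy ye]] := lp (ball x0 e); first exact: nbhsx_ballx.
have rolle a b : a < b -> f a = 0 -> f b = 0 ->
    exists2 c, c \in `]a, b[ & df c = 0.
  move=> ab fa fb.
  have [||c cab c0] := @Rolle _ f a b ab _ (continuous_subspaceT cf).
  - by move=> t _; case: (fdf t).
  - by rewrite fa fb.
  - exists c => //; have /@derive_val <- := fdf c; exact: derive_val.
move: ye; rewrite /ball/= => ye.
have [xy|yx|xy] := ltgtP x0 y; last by rewrite xy eqxx in yx0.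
- have [c cI dfc] := rolle _ _ xy fx0 fy.
  move: cI; rewrite in_itv/= => /andP[x0c cy].
  exists c; split => //=; first by rewrite gt_eqF.
  apply: eU; rewrite /ball/= (le_lt_trans _ ye)//.
  by rewrite distrC [leRHS]distrC !gtr0_norm ?subr_gt0// lerD2r ltW.
- have [c cI dfc] := rolle _ _ yx fy fx0.
  move: cI; rewrite in_itv/= => /andP[yc cx0].
  exists c; split => //=; first by rewrite lt_eqF.
  apply: eU; rewrite /ball/= (le_lt_trans _ ye)//.
  by rewrite !gtr0_norm ?subr_gt0// lerD2l lerN2 ltW.
Qed.

(** For a function whose n-th derivative is O(s^n), as for the restriction of an
entire function of exponential type, the mean value theorem shows that a point
where all derivatives vanish has a neighbourhood of such points, whose radius
does not depend on the point. *)
Section geometric_derivatives.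
Variables (h : nat -> R -> R) (M s : R).
Hypothesis s0 : 0 < s.
Hypothesis dh : forall n (x : R), is_derive x 1 (h n) (h n.+1 x).
Hypothesis hM : forall n x, `|h n x| <= M * s ^+ n.

(** Each application of the mean value theorem costs a factor [s] for the extra
derivative and gains the radius 1 / (2s), so the bound is halved. *)
Lemma flat_local_zero x0 x : (forall n, h n x0 = 0) ->
  `|x - x0| <= (2 * s)^-1 -> forall n, h n x = 0.
Proof.
move=> h0 + n; have M0 : 0 <= M.
  by have := le_trans (normr_ge0 _) (hM 0 0); rewrite expr0 mulr1.
have key k : forall m y, `|y - x0| <= (2 * s)^-1 ->
    `|h m y| <= M * s ^+ m * 2^-1 ^+ k.
  elim: k => [|k IH] m y yx0; first by rewrite expr0 mulr1.
  have [c cy] := derive_global_MVT x0 y (dh m).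
  rewrite h0 subr0 => ->; rewrite normrM.
  have -> : M * s ^+ m * 2^-1 ^+ k.+1 =
      (M * s ^+ m.+1 * 2^-1 ^+ k) * (2 * s)^-1.
    by rewrite !exprS; field; rewrite gt_eqF.
  by rewrite ler_pM// IH// (le_trans cy).
move=> xx0; apply/eqP; rewrite -normr_le0; apply/ler_addgt0Pl => e e0.
rewrite addr0; set B := M * s ^+ n.
have B0 : 0 <= B by rewrite mulr_ge0// exprn_ge0// ltW.
have [k Bk] : exists k : nat, B / e < k.+1%:R.
  by exists (Num.Def.truncn (B / e)); exact: truncnS_gt.
apply: (le_trans (key k n x xx0)); rewrite -/B exprVn ler_pdivrMr ?exprn_gt0//.
move: Bk; rewrite ltr_pdivrMr// mulrC => /ltW Bk; apply: (le_trans Bk).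
by rewrite ler_pM2l// -natrX ler_nat ltn_expl.
Qed.

(** The radius in [flat_local_zero] is uniform, so finitely many steps reach any
point. *)
Lemma flat_zero x0 x : (forall n, h n x0 = 0) -> h 0%N x = 0.
Proof.
move=> h0.
have key m : forall y, `|y - x0| <= m%:R * (2 * s)^-1 -> forall n, h n y = 0.
  elim: m => [|m IH] y.
    by rewrite mul0r normr_le0 subr_eq0 => /eqP ->.
  move=> yx0; set z := x0 + (y - x0) * (m%:R / m.+1%:R).
  have zx0 : `|z - x0| <= m%:R * (2 * s)^-1.
    rewrite /z addrC addKr normrM [X in _ * X]ger0_norm ?divr_ge0//.
    have -> : m%:R * (2 * s)^-1 = m.+1%:R * (2 * s)^-1 * (m%:R / m.+1%:R).
      by rewrite -natr1; field; rewrite nat1r pnatr_eq0/= gt_eqF.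
    by rewrite ler_wpM2r// divr_ge0.
  apply: (flat_local_zero (x0 := z)); first exact: IH.
  have -> : y - z = (y - x0) / m.+1%:R.
    by rewrite /z -natr1; field; rewrite natr1 pnatr_eq0.
  rewrite normrM [X in _ * X]ger0_norm ?invr_ge0// ler_pdivrMr ?ltr0n//.
  by rewrite mulrC.
apply: (key (Num.Def.truncn (`|x - x0| * (2 * s))).+1).
rewrite ler_pdivlMr ?mulr_gt0//; apply/ltW; exact: truncnS_gt.
Qed.

Lemma limit_point_zeros_zero x0 x :
  limit_point [set y | h 0%N y = 0] x0 -> h 0%N x = 0.
Proof.
move=> lp; apply: (@flat_zero x0) => n.
have: limit_point [set y | h n y = 0] x0.
  by elim: n => // n IH; case: (limit_point_zeros_derive (dh n) IH).
by case/(limit_point_zeros_derive (dh n)).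
Qed.

End geometric_derivatives.

Lemma is_derive_trigint (sigma : R) (C S : R -> R) (x : R) :
  continuous C -> continuous S ->
  is_derive x 1 (trigint sigma C S)
    (trigint sigma (fun t => t * S t) (fun t => - (t * C t)) x).
Proof.
move=> cC cS.
pose f (y t : R) := C t * cos (t * y) + S t * sin (t * y).
have df (y t : R) : is_derive y 1 (f ^~ t)
    (t * S t * cos (t * y) + - (t * C t) * sin (t * y)).
  by apply: is_derive_eq; rewrite /GRing.scale/=; ring.
have pf (y t : R) : partial1of2 f y t =
    t * S t * cos (t * y) + - (t * C t) * sin (t * y).
  by rewrite partial1of2E; apply: derive_val.
pose G (t : R) : R := `|t * S t| + `|t * C t|.
have cG : continuous G by rewrite /G; cont.
have Ix : `]x - 1, x + 1[%classic x.
  by rewrite /= in_itv/=; apply/andP; split; lra.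
have mI : measurable (`[0, sigma]%classic : set (measurableTypeR R)).
  exact: measurable_itv.
have intf (y : R) : `]x - 1, x + 1[%classic y ->
    lebesgue_measure.-integrable `[0, sigma] (EFin \o f y).
  by move=> _; apply: integrable0; rewrite /f; cont.
have derf (y t : R) : `]x - 1, x + 1[%classic y -> `[0, sigma]%classic t ->
    derivable (f ^~ t) y 1 by move=> _ _; case: (df y t).
have G0 (t : R) : 0 <= G t by rewrite addr_ge0.
have Gub (y t : R) : `]x - 1, x + 1[%classic y -> `[0, sigma]%classic t ->
    `|partial1of2 f y t| <= G t.
  move=> _ _; rewrite pf (le_trans (ler_normD _ _))// /G lerD// normrM.
    by rewrite ler_piMr// cos_max.
  by rewrite normrN ler_piMr// sin_max.
have intG := integrable0 sigma cG.
apply: DeriveDef.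
  exact: (derivable_under_integral mI Ix intf derf G0 intG Gub).
rewrite -derive1E (differentiation_under_integral mI Ix intf derf G0 intG Gub).
by apply: eq_Rintegral => t _; rewrite pf.
Qed.

(** All derivatives of [trigint sigma C S] are again of the form [trigint], with
coefficients multiplied by powers of t <= sigma, hence O(sigma^n). *)
Lemma trigint_identity (sigma : R) (C S : R -> R) (x0 : R) : 0 < sigma ->
  continuous C -> continuous S ->
  limit_point [set y | trigint sigma C S y = 0] x0 ->
  forall x, trigint sigma C S x = 0.
Proof.
move=> s0 cC cS lp x.
(* By is_derive_trigint, this is differentiation on pairs of coefficients. *)
pose step (p : (R -> R) * (R -> R)) :=
  ((fun t : R => t * p.2 t), (fun t : R => - (t * p.1 t))).
pose q n := iter n step (C, S).
have cq n : continuous (q n).1 /\ continuous (q n).2.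
  by elim: n => [//|n [c1 c2]]; split=> /=; cont.
pose h n := trigint sigma (q n).1 (q n).2.
have [t1 _ Ht1] :=
  EVT_max (ltW s0) (continuous_subspaceT (continuous_normf cC)).
have [t2 _ Ht2] :=
  EVT_max (ltW s0) (continuous_subspaceT (continuous_normf cS)).
pose M : R := `|C t1| + `|S t2|.
have M0 : 0 <= M by rewrite addr_ge0.
have qM n (t : R) : 0 <= t <= sigma ->
    `|(q n).1 t| <= M * sigma ^+ n /\ `|(q n).2 t| <= M * sigma ^+ n.
  move=> ts; have [t0 tsig] := andP ts.
  elim: n => [|n [I1 I2]] /=.
    rewrite expr0 mulr1; split.
      by rewrite (le_trans (Ht1 t _)) ?in_itv// /M lerDl.
    by rewrite (le_trans (Ht2 t _)) ?in_itv// /M lerDr.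
  rewrite normrN !normrM (ger0_norm t0) exprS mulrCA.
  by split; apply: ler_pM.
apply: (@limit_point_zeros_zero h (2 * M * sigma) sigma s0 _ _ x0 x lp).
- by move=> n y; have [c1 c2] := cq n; exact: is_derive_trigint.
- move=> n y; have [c1 c2] := cq n.
  apply: (le_trans (int0_norm_le (g := fun=> 2 * (M * sigma ^+ n)) _ _ _)).
  + by cont.
  + by cont.
  + move=> t ts; have [q1 q2] := qM n t ts.
    rewrite (le_trans (ler_normD _ _))// !normrM.
    have e1 : `|(q n).1 t| * `|cos (t * y)| <= `|(q n).1 t|.
      by rewrite ler_piMr// cos_max.
    have e2 : `|(q n).2 t| * `|sin (t * y)| <= `|(q n).2 t|.
      by rewrite ler_piMr// sin_max.
    by lra.
  + by rewrite (int0_cst _ (ltW s0)) le_eqVlt; apply/orP; left; apply/eqP; ring.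
Qed.

End identity_theorem.

(** * Cosine and sine transforms of a weighted measure *)

(** The measure transformed is the image under [X] of the measure of density [w]
with respect to [mu]. Keeping [X] and [w] apart from [mu] treats uniformly a
Borel probability measure and a density with respect to the completed Lebesgue
measure, although they live on different sigma-algebras of the line. *)
Section weighted_transform.
Context d (T : measurableType d) (R : realType).
Variables (mu : {sigma_finite_measure set T -> \bar R}).
Variables (X w : T -> R).
Hypothesis mX : measurable_fun setT X.
Hypothesis w0 : forall x, 0 <= w x.
Hypothesis iw : mu.-integrable setT (EFin \o w).

Definition costr (t : R) : R := \int[mu]_x (w x * cos (t * X x)).
Definition sintr (t : R) : R := \int[mu]_x (w x * sin (t * X x)).

Let mw : measurable_fun setT w.
Proof. by case/integrableP : iw => /measurable_EFinP. Qed.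

Let mcont (g : R -> R) (h : T -> R) : continuous g -> measurable_fun setT h ->
  measurable_fun setT (fun x => g (h x)).
Proof.
move=> cg mh; apply: (measurableT_comp (f := g)) => //.
exact: continuous_measurable_fun.
Qed.

Lemma integrable_bounded_weight (h : T -> R) (M : R) : measurable_fun setT h ->
  (forall x, `|h x| <= M) -> mu.-integrable setT (EFin \o (fun x => w x * h x)).
Proof.
move=> mh hM.
apply: (le_integrable measurableT (g := fun x => (M%:E * (w x)%:E)%E)).
- by apply/measurable_EFinP; exact: measurable_funM.
- move=> x _ /=; rewrite lee_fin !normrM (ger0_norm (w0 x)) mulrC ler_wpM2r//.
  by rewrite (le_trans (hM x))// ler_norm.
- exact: integrableZl.
Qed.

Lemma continuous_costr : continuous costr.
Proof.
move=> t; rewrite /costr.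
have It : t \in `]t - 1, t + 1[%classic.
  by rewrite inE/= in_itv/=; apply/andP; split; lra.
apply: (@continuity_under_integral R d T mu _ setT measurableT (t - 1) (t + 1)
  _ _ w iw _ t It).
- move=> s _; apply: (integrable_bounded_weight (M := 1)).
    apply: (mcont (@continuous_cos R)); exact: measurable_funM.
  by move=> x; exact: cos_max.
- by apply/aeW => x _ s _; apply: (_ : continuous _); cont.
- move=> s _; apply/aeW => x _.
  by rewrite normrM ger0_norm// ler_piMr// cos_max.
Qed.

Lemma continuous_sintr : continuous sintr.
Proof.
move=> t; rewrite /sintr.
have It : t \in `]t - 1, t + 1[%classic.
  by rewrite inE/= in_itv/=; apply/andP; split; lra.
apply: (@continuity_under_integral R d T mu _ setT measurableT (t - 1) (t + 1)
  _ _ w iw _ t It).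
- move=> s _; apply: (integrable_bounded_weight (M := 1)).
    apply: (mcont (@continuous_sin R)); exact: measurable_funM.
  by move=> x; exact: sin_max.
- by apply/aeW => x _ s _; apply: (_ : continuous _); cont.
- move=> s _; apply/aeW => x _.
  by rewrite normrM ger0_norm// ler_piMr// sin_max.
Qed.

Lemma costrN t : costr (- t) = costr t.
Proof. by apply: eq_Rintegral => x _; rewrite mulNr cosN. Qed.

Lemma sintrN t : sintr (- t) = - sintr t.
Proof.
rewrite /sintr -[RHS]mulN1r -RintegralZl//.
  by apply: eq_Rintegral => x _; rewrite mulNr sinN mulrN mulN1r.
apply: (integrable_bounded_weight (M := 1)); last by move=> x; exact: sin_max.
apply: (mcont (@continuous_sin R)); exact: measurable_funM.
Qed.

(** The Parseval formula: a transform paired with [a] and [b] over [0, A] is the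
measure paired with the inverse transform of [a] and [b]. *)
Lemma fubini_trigint (A : R) (a b : R -> R) : continuous a -> continuous b ->
  int0 A (fun t => costr t * a t + sintr t * b t) =
  \int[mu]_x (w x * trigint A a b (X x)).
Proof.
move=> ca cb.
pose k (y t : R) := a t * cos (t * y) + b t * sin (t * y).
have ck y : continuous (k y) by rewrite /k; cont.
pose F (z : measurableTypeR R * T) : R :=
  \1_(`[0, A]%classic : set (measurableTypeR R)) z.1 * (w z.2 * k (X z.2) z.1).
have mF : measurable_fun setT F.
  have mfst (g : R -> R) : continuous g ->
      measurable_fun setT (fun z : measurableTypeR R * T => g z.1).
    move=> cg; apply: (measurableT_comp (f := g)); last exact: measurable_fst.
    exact: continuous_measurable_fun.
  have mXz : measurable_fun setT (fun z : measurableTypeR R * T => z.1 * X z.2).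
    apply: measurable_funM; first exact: measurable_fst.
    by apply: measurableT_comp => //; exact: measurable_snd.
  apply: measurable_funM.
    apply: (measurableT_comp (f :=
        \1_(`[0, A]%classic : set (measurableTypeR R)) : _ -> R)).
      exact: measurable_indic.
    exact: measurable_fst.
  apply: measurable_funM.
    by apply: measurableT_comp => //; exact: measurable_snd.
  apply: measurable_funD; apply: measurable_funM; [exact: mfst| |exact: mfst|].
    apply: (measurableT_comp (f := cos)) => //.
    by apply: continuous_measurable_fun; exact: continuous_cos.
  apply: (measurableT_comp (f := sin)) => //.
  by apply: continuous_measurable_fun; exact: continuous_sin.
pose G t := `|a t| + `|b t|.
have cG : continuous G by rewrite /G; cont.
have kG y t : `|k y t| <= G t.
  rewrite (le_trans (ler_normD _ _))// !normrM /G lerD// ler_piMr//.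
    exact: cos_max.
  exact: sin_max.
have iF : (lebesgue_measure \x mu)%E.-integrable setT (EFin \o F).
  apply/integrable21ltyP; first exact/measurable_EFinP.
  apply: (@le_lt_trans _ _ (\int[mu]_x ((int0 A G)%:E * (w x)%:E))%E).
    apply: ge0_le_integral => //.
    - by move=> x _; exact: integral_ge0.
    - apply: (measurable_fun_fubini_tonelli_G (abse \o EFin \o F)) => //=.
      by apply: measurableT_comp => //; exact/measurable_EFinP.
    - by apply/measurable_funeM; exact/measurable_EFinP.
    - move=> x _ /=.
      have <- : (\int[lebesgue_measure]_t
          ((\1_(`[0%R, A]%classic) t * (w x * G t))%:E) =
          (int0 A G)%:E * (w x)%:E)%E.
        rewrite integral_indic0 ?int0Z ?EFinM 1?muleC//.
        by apply: continuous_mulf => //; exact: continuous_cst.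
      apply: ge0_le_integral => //.
      + apply: (measurable_fun_pair1 (f := fun z => `|(F z)%:E|%E)).
        by apply: measurableT_comp => //; exact/measurable_EFinP.
      + apply/measurable_EFinP; apply: measurable_funM.
          exact: measurable_indic.
        apply: measurable_funM => //; exact: continuous_measurable_fun.
      + move=> t _; rewrite lee_fin /F/= !normrM (ger0_norm (w0 x)).
        rewrite ger0_norm// ler_wpM2l// ler_wpM2l//.
  rewrite integralZl//.
  have := integrable_fin_num measurableT iw.
  by case: (integral _ _ _) => // r _; rewrite -EFinM ltry.
have E := Fubini iF.
have ic (t : R) : mu.-integrable setT (EFin \o (fun x => w x * cos (t * X x))).
  apply: (integrable_bounded_weight (M := 1)); last by move=> x; exact: cos_max.
  apply: (mcont (@continuous_cos R)); exact: measurable_funM.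
have is_ (t : R) : mu.-integrable setT (EFin \o (fun x => w x * sin (t * X x))).
  apply: (integrable_bounded_weight (M := 1)); last by move=> x; exact: sin_max.
  apply: (mcont (@continuous_sin R)); exact: measurable_funM.
have [cc cs] := (continuous_costr, continuous_sintr).
have E1 : (int0 A (fun t => costr t * a t + sintr t * b t))%:E =
    (\int[lebesgue_measure]_t \int[mu]_x (F (t, x))%:E)%E.
  rewrite -integral_indic0; last by cont.
  apply: eq_integral => t _; rewrite /F/=.
  under [RHS]eq_integral do rewrite EFinM.
  rewrite integralZl//; last first.
    apply: (integrable_bounded_weight (M := G t)) => //.
    by apply: measurable_funD; apply: measurable_funM => //; apply: mcont;
      (exact: continuous_cos || exact: continuous_sin ||
       exact: measurable_funM).
  rewrite EFinM; congr (_ * _)%E.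
  rewrite [costr t * _]mulrC [sintr t * _]mulrC.
  rewrite /costr /sintr -!RintegralZl// -RintegralD//; last 2 first.
  - exact: (integrableZl measurableT (a t) (ic t)).
  - exact: (integrableZl measurableT (b t) (is_ t)).
  rewrite fineK.
    by apply: eq_integral => x _; congr EFin; rewrite /k; ring.
  apply: integrable_fin_num => //.
  exact: (integrableD measurableT (integrableZl measurableT (a t) (ic t))
    (integrableZl measurableT (b t) (is_ t))).
rewrite /Rintegral (_ : integral _ _ _ = (int0 A
    (fun t => costr t * a t + sintr t * b t))%:E)//.
rewrite E1 [RHS]E; apply: eq_integral => x _; rewrite /F/= integral_indic0.
  by rewrite int0Z.
by apply: continuous_mulf => //; exact: continuous_cst.
Qed.

End weighted_transform.

(** * Lattices that avoid a set of small measure *)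

Section lattice_avoidance.
Variable R : realType.
Local Notation leb := (@lebesgue_measure R).

Let preimage_shift_itv (c a b : R) :
  (fun x : R => x + c) @^-1` `]a, b] = `]a - c, b - c]%classic.
Proof.
by apply/seteqP; split => x /=; rewrite !in_itv/= ltrBlDr lerBrDr.
Qed.

Lemma lebesgue_measure_shift (c : R) (A : set (measurableTypeR R)) :
  measurable A -> leb ((fun x => x + c) @^-1` A) = leb A.
Proof.
move=> mA; have mf : measurable_fun setT
    ((fun x => x + c) : measurableTypeR R -> measurableTypeR R).
  exact: measurable_funD.
pose f : {mfun measurableTypeR R >-> measurableTypeR R} :=
  HB.pack ((fun x => x + c) : measurableTypeR R -> measurableTypeR R)
  (isMeasurableFun.Build _ _ _ _ _ mf).
transitivity (pushforward leb f A); first by [].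
apply/esym/lebesgue_measure_unique => //= _ [[a b]] _ <-.
rewrite /pushforward preimage_shift_itv !lebesgue_measure_itv/=.
by rewrite !lte_fin ltrD2r -!EFinB [in RHS]opprD [in RHS]addrACA subrr addr0.
Qed.

(* An explicit bijection between nat and int, to index the tiles of the line by
   natural numbers as the countable additivity of measures requires. *)
Let decode (n : nat) : int := if odd n then Negz n./2 else Posz n./2.
Let code (k : int) : nat :=
  match k with Posz m => m.*2 | Negz m => m.*2.+1 end.

Let codeK : cancel code decode.
Proof.
by case=> m; rewrite /decode /code /= ?odd_double//= ?doubleK// uphalf_double.
Qed.

Let decodeK : cancel decode code.
Proof.
move=> n; rewrite /decode; case: ifP => on /=.
  by have := odd_double_half n; rewrite on add1n.
by have := odd_double_half n; rewrite on add0n.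
Qed.

(** The tiles kp <= x < (k+1)p cut [A] into pieces; translated back to the tile
k = 0 they have total measure at most that of [A], so their union misses a set
of positive measure, which cannot be finite. *)
Lemma lattice_avoiding_infinite (p : R) (A : set (measurableTypeR R)) :
  0 < p -> measurable A -> (leb A < p%:E)%E ->
  infinite_set [set x : R | 0 <= x < p /\ forall k : int, ~ A (x + k%:~R * p)].
Proof.
move=> p0 mA Ap finE.
set E := [set x | _] in finE.
pose c n : R := (decode n)%:~R * p.
pose D n : set (measurableTypeR R) := `[c n, c n + p[%classic.
pose B n : set (measurableTypeR R) := (fun x => x + c n) @^-1` (A `&` D n).
have mAD n : measurable (A `&` D n).
  by apply: measurableI => //; exact: measurable_itv.
have mB n : measurable (B n).
  rewrite -[B n]setTI; have : measurable_fun setT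
    ((fun x => x + c n) : measurableTypeR R -> measurableTypeR R).
    exact: measurable_funD.
  by apply.
have Dfloor n x : D n x -> Num.floor (x / p) = decode n.
  rewrite /D /= in_itv/= => /andP[cx xc]; apply: floor_def.
  by rewrite intrD ler_pdivlMr// ltr_pdivrMr// mulrDl mul1r cx.
have tD : trivIset setT (fun n => A `&` D n).
  move=> m n _ _ [x [[_ /Dfloor em] [_ /Dfloor en]]].
  by apply: (can_inj decodeK); rewrite -em en.
have sumB : (\sum_(n <oo) leb (B n) <= leb A)%E.
  rewrite (eq_eseriesr (g := fun n => leb (A `&` D n))); last first.
    by move=> n _; exact: lebesgue_measure_shift.
  rewrite -(@measure_semi_bigcup _ _ _ leb)//; last exact: bigcupT_measurable.
  apply: le_measure; rewrite ?inE//; first exact: bigcupT_measurable.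
  by apply: bigcup_sub => n _ x [].
have mU : measurable (\bigcup_n B n) by exact: bigcupT_measurable.
have UB : (leb (\bigcup_n B n) < p%:E)%E.
  apply: le_lt_trans Ap; apply: le_trans sumB.
  exact: generalized_Boole_inequality.
have mE : measurable (E : set (measurableTypeR R)).
  exact: countable_measurable (finite_set_countable finE).
have E0 : leb E = 0%E.
  exact: countable_lebesgue_measure0 (finite_set_countable finE).
have cover : (`[0, p[%classic : set (measurableTypeR R)) `<=`
    (\bigcup_n B n) `|` E.
  move=> x; rewrite /= in_itv/= => x0p.
  have [Ex|] := pselect (E x); first by right.
  move=> nE; left; apply: contrapT => nB; apply: nE; split => // k Axk.
  apply: nB; exists (code k) => //; rewrite /B /D /c /= codeK; split => //.
  move: x0p => /andP[? ?].
  by rewrite /= in_itv/= lerDr addrC ltrD2l; apply/andP.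
have : (p%:E <= leb (\bigcup_n B n) + leb E)%E.
  have <- : leb `[0, p[%classic = p%:E.
    by rewrite lebesgue_measure_itv/= lte_fin p0 sube0.
  apply: le_trans (measureU2 _ _ _) => //.
  by apply: le_measure; rewrite ?inE//; exact: measurableU.
by rewrite E0 adde0 leNgt UB.
Qed.

End lattice_avoidance.

(** * Two measures whose transforms agree beyond sigma *)

Section integral_extras.
Variable R : realType.

Lemma int0_cut (sigma A : R) (f : R -> R) : sigma <= A ->
  (forall t, sigma <= t -> f t = 0) -> int0 A f = int0 sigma f.
Proof.
move=> sA f0; rewrite /int0 Rintegral_mkcond [RHS]Rintegral_mkcond.
congr Rintegral; apply/funext => t; rewrite !patchE !mem_setE !in_itv/=.
have [t0|//] := leP 0 t; rewrite /=.
have [ts|st] := leP t sigma; first by rewrite (le_trans ts sA).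
by rewrite f0 ?if_same// ltW.
Qed.

Lemma int0_eq0 (A : R) (f : R -> R) : 0 < A -> continuous f ->
  (forall t, 0 <= f t) -> int0 A f = 0 -> forall t, 0 <= t <= A -> f t = 0.
Proof.
move=> A0 cf f0 If t /andP[t0 tA]; apply/eqP/negPn/negP => ft.
have {}ft : 0 < f t by rewrite lt_neqAle eq_sym ft f0.
have ft2 : 0 < f t / 2 by rewrite divr_gt0.
have /cvgrPdist_lt/(_ _ ft2) [e /= e0 He] := cf t.
pose u := Num.max 0 (t - e / 2); pose v := Num.min A (t + e / 2).
have e2 : 0 < e / 2 by rewrite divr_gt0.
have uv : u < v.
  by rewrite gt_max !lt_min A0 /=; apply/and3P; split; lra.
have uvA : `[u, v]%classic `<=` `[0, A]%classic.
  by apply: subset_itvScc; rewrite bnd_simp ?le_max ?ge_min lexx.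
have ge2 s : `[u, v]%classic s -> f t / 2 <= f s.
  rewrite /= in_itv/= => /andP[us sv].
  have us' : t - e / 2 <= s by rewrite (le_trans _ us)// le_max lexx orbT.
  have sv' : s <= t + e / 2 by rewrite (le_trans sv)// ge_min lexx orbT.
  have : `|t - s| < e by rewrite ltr_norml; apply/andP; split; lra.
  by move/He; rewrite ltr_norml => /andP[_]; lra.
have : ((f t / 2 * (v - u))%:E <= 0)%E.
  have -> : 0%E = (int0 A f)%:E by rewrite If.
  rewrite /int0 fineK; last first.
    by apply: integrable_fin_num => //; exact: integrable0.
  have mf B : measurable_fun (B : set (measurableTypeR R)) (EFin \o f).
    by apply/measurable_EFinP; apply: measurable_funTS;
      exact: continuous_measurable_fun.
  apply: (@le_trans _ _ (\int[lebesgue_measure]_(s in `[u, v]) (f s)%:E)%E).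
    have -> : (f t / 2 * (v - u))%:E =
        (\int[lebesgue_measure]_(s in `[u, v]) (f t / 2)%:E)%E.
      rewrite integral_cst//.
      have := @lebesgue_measure_itv R `[u, v].
      by rewrite /= lte_fin uv -EFinB => ->; rewrite EFinM.
    by apply: ge0_le_integral => // s _; rewrite lee_fin ltW.
  apply: ge0_subset_integral => //.
  by move=> s _; rewrite lee_fin.
by rewrite lee_fin leNgt mulr_gt0// subr_gt0.
Qed.

End integral_extras.

Section signed_transform.
Context (R : realType).
Context d1 (T1 : measurableType d1)
  (mu1 : {sigma_finite_measure set T1 -> \bar R}).
Context d2 (T2 : measurableType d2)
  (mu2 : {sigma_finite_measure set T2 -> \bar R}).
Variables (X1 w1 : T1 -> R) (X2 w2 : T2 -> R) (sigma : R).
Hypothesis mX1 : measurable_fun setT X1.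
Hypothesis w1_ge0 : forall x, 0 <= w1 x.
Hypothesis iw1 : mu1.-integrable setT (EFin \o w1).
Hypothesis mX2 : measurable_fun setT X2.
Hypothesis w2_ge0 : forall x, 0 <= w2 x.
Hypothesis iw2 : mu2.-integrable setT (EFin \o w2).
Hypothesis sigma0 : 0 < sigma.

Local Notation C := (fun t => costr mu2 X2 w2 t - costr mu1 X1 w1 t).
Local Notation S := (fun t => sintr mu2 X2 w2 t - sintr mu1 X1 w1 t).

Hypothesis C_cut : forall t, sigma <= t -> C t = 0.
Hypothesis S_cut : forall t, sigma <= t -> S t = 0.

Let cc1 : continuous (costr mu1 X1 w1) := continuous_costr mX1 w1_ge0 iw1.
Let cs1 : continuous (sintr mu1 X1 w1) := continuous_sintr mX1 w1_ge0 iw1.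
Let cc2 : continuous (costr mu2 X2 w2) := continuous_costr mX2 w2_ge0 iw2.
Let cs2 : continuous (sintr mu2 X2 w2) := continuous_sintr mX2 w2_ge0 iw2.

Let cC : continuous C. Proof. by cont. Qed.
Let cS : continuous S. Proof. by cont. Qed.

Let fubini_diff (A : R) (a b : R -> R) : continuous a -> continuous b ->
  int0 A (fun t => C t * a t + S t * b t) =
  \int[mu2]_x (w2 x * trigint A a b (X2 x)) -
  \int[mu1]_x (w1 x * trigint A a b (X1 x)).
Proof.
move=> ca cb; rewrite -!fubini_trigint// -int0B; [|by cont..].
by apply: eq_int0 => t _; ring.
Qed.

(** Integrating the inverse transform of (C, S) against the difference of the two
measures gives the squared norm of (C, S) over [0, sigma]. *)
Lemma transform_diff_eq0 : (forall x : R, trigint sigma C S x = 0) ->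
  forall t : R, 0 <= t <= sigma -> C t = 0 /\ S t = 0.
Proof.
move=> H0 t ts; pose Q (t : R) := C t * C t + S t * S t.
have cQ : continuous Q by rewrite /Q; cont.
have Q0 s : 0 <= Q s by rewrite addr_ge0// -expr2 sqr_ge0.
have IQ : int0 sigma Q = 0.
  rewrite /Q fubini_diff//.
  under eq_Rintegral do rewrite H0 mulr0.
  under [X in _ - X]eq_Rintegral do rewrite H0 mulr0.
  by rewrite !Rintegral_cst// !mul0r subrr.
have /eqP := int0_eq0 sigma0 cQ Q0 IQ ts.
by rewrite /Q -!expr2 paddr_eq0 ?sqr_ge0// !sqrf_eq0 => /andP[/eqP -> /eqP ->].
Qed.

Let trigint_triangle (A x0 y : R) :
  trigint A (fun t => (1 - t / A) * cos (t * x0))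
            (fun t => (1 - t / A) * sin (t * x0)) y =
  int0 A (fun t => (1 - t / A) * cos (t * (y - x0))).
Proof. by apply: eq_int0 => t _; rewrite mulrBr cosB; ring. Qed.

(** Cesaro summation of the inverse transform. With the weight 1 - t/A the inverse
transform at x0 becomes the integral of the difference of the measures against
a nonnegative kernel. The second measure contributes a nonnegative amount, and
the first lives at distance at least e from x0, where the kernel is at most
2 / (A e^2). Since C and S vanish beyond sigma, removing the weight costs only
O(1/A). *)
Lemma trigint_off_support_ge0 (x0 e : R) : 0 < e ->
  {ae mu1, forall x, `|X1 x - x0| < e -> w1 x = 0} ->
  0 <= trigint sigma C S x0.
Proof.
move=> e0 w1off.
pose W := \int[mu1]_x w1 x.
pose F (t : R) := C t * cos (t * x0) + S t * sin (t * x0).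
have cF : continuous F by rewrite /F; cont.
pose K := int0 sigma (fun t => t * F t).
have main (A : R) : sigma <= A -> 0 < A ->
    (K - 2 / e ^+ 2 * W) / A <= trigint sigma C S x0.
  move=> sA A0.
  pose a (t : R) := (1 - t / A) * cos (t * x0).
  pose b (t : R) := (1 - t / A) * sin (t * x0).
  have ca : continuous a by rewrite /a; cont.
  have cb : continuous b by rewrite /b; cont.
  have lhs : int0 A (fun t => C t * a t + S t * b t) =
      trigint sigma C S x0 - A^-1 * K.
    rewrite (int0_cut sA); last first.
      by move=> t st; rewrite C_cut// S_cut// !mul0r addr0.
    rewrite /K -int0Z ?/trigint -?int0B//; [|by cont..].
    by apply: eq_int0 => t _; rewrite /a /b /F; ring.
  have Q1 : 0 <= \int[mu2]_x (w2 x * trigint A a b (X2 x)).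
    apply: Rintegral_ge0 => x _; rewrite mulr_ge0//.
    by rewrite trigint_triangle int0_triangle_ge0.
  have Q2 : \int[mu1]_x (w1 x * trigint A a b (X1 x)) <= 2 / (A * e ^+ 2) * W.
    have mtrig : measurable_fun setT (fun x => w1 x * trigint A a b (X1 x)).
      apply: measurable_funM.
        by case/integrableP : iw1 => /measurable_EFinP.
      apply: (measurableT_comp (f := trigint A a b)) => //.
      apply: continuous_measurable_fun => y.
      by apply/differentiable_continuous/derivable1_diffP;
        case: (is_derive_trigint A y ca cb).
    have le12 : (\int[mu1]_x (w1 x * trigint A a b (X1 x))%:E <=
        \int[mu1]_x (2 / (A * e ^+ 2) * w1 x)%:E)%E.
      apply: ae_ge0_le_integral => //.
      - move=> x _; rewrite lee_fin mulr_ge0//.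
        by rewrite trigint_triangle int0_triangle_ge0.
      - exact/measurable_EFinP.
      - move=> x _; rewrite lee_fin mulr_ge0// divr_ge0// mulr_ge0 ?sqr_ge0//.
        exact: ltW.
      - apply/measurable_EFinP; apply: measurable_funM => //.
        by case/integrableP : iw1 => /measurable_EFinP.
      - apply: filterS w1off => x w1x _; rewrite lee_fin.
        have [/w1x ->|ex] := ltP `|X1 x - x0| e; first by rewrite mul0r mulr0.
        rewrite mulrC ler_wpM2r// trigint_triangle.
        have xx0 : X1 x - x0 != 0.
          by rewrite -normr_gt0 (lt_le_trans e0).
        apply: (le_trans (int0_triangle_le A0 xx0)).
        have xx2 : 0 < (X1 x - x0) ^+ 2 by rewrite exprn_even_gt0.
        have ee2 : 0 < e ^+ 2 by rewrite exprn_gt0.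
        rewrite ler_pM2l// lef_pV2 ?posrE; last 2 first.
        - exact: mulr_gt0.
        - exact: mulr_gt0.
        rewrite ler_pM2l// -[leRHS]real_normK ?num_real//.
        by rewrite ler_sqr ?nnegrE// ltW.
    have i2 := integrableZl measurableT (2 / (A * e ^+ 2)) iw1.
    have f2 := integrable_fin_num measurableT i2.
    rewrite /W -RintegralZl// fine_le//.
    rewrite ge0_fin_numE; last first.
      apply: integral_ge0 => x _; rewrite lee_fin mulr_ge0//.
      by rewrite trigint_triangle int0_triangle_ge0.
    by rewrite (le_lt_trans le12)// ltey_eq f2.
  have := fubini_diff A ca cb; rewrite lhs => E.
  have -> : (K - 2 / e ^+ 2 * W) / A = A^-1 * K - 2 / (A * e ^+ 2) * W.
    by field; rewrite !gt_eqF.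
  by lra.
apply/ler_addgt0Pl => r r0.
pose B := K - 2 / e ^+ 2 * W.
(* Large enough for |B| / A <= r, and at least sigma as main requires. *)
pose A := sigma + `|B| / r.
have A0 : 0 < A by rewrite ltr_pwDl// divr_ge0// ltW.
have sA : sigma <= A by rewrite lerDl divr_ge0// ltW.
have := main A sA A0; rewrite -/B.
suff : - r <= B / A by lra.
rewrite ler_pdivlMr// mulNr lerNl (le_trans (ler_norm _))// normrN.
by rewrite /A mulrDr mulrCA divff ?gt_eqF// mulr1 lerDr mulr_ge0// ltW.
Qed.

(** The set [A] contains every point near which the first measure has mass. The
points of the tile 0 <= x < 2 pi / sigma whose lattice avoids [A] form a bounded
infinite set on which the inverse transform vanishes, hence it vanishes
everywhere. *)
Lemma small_support_transform_diff_eq0 (A : set (measurableTypeR R)) :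
  measurable A -> (lebesgue_measure A < (2 * pi / sigma)%:E)%E ->
  (forall x0 : R, ~ A x0 -> exists2 e : R, 0 < e &
    {ae mu1, forall x, `|X1 x - x0| < e -> w1 x = 0}) ->
  C 0 = 0 -> forall t : R, 0 <= t <= sigma -> C t = 0 /\ S t = 0.
Proof.
move=> mA lA offA C0; apply: transform_diff_eq0.
have p0 : 0 < 2 * pi / sigma by rewrite divr_gt0// mulr_gt0// pi_gt0.
have infE := lattice_avoiding_infinite p0 mA lA.
set E := [set x | _] in infE.
have bE : bounded_set E.
  exists (2 * pi / sigma); split; first exact: num_real.
  move=> M pM x [/andP[x0 xp] _] /=; rewrite ger0_norm//.
  by rewrite (le_trans (ltW xp))// ltW.
have [x0 lp] := infinite_bounded_limit_point_nonempty infE bE.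
apply: (trigint_identity (x0 := x0)) => // U /lp[y [yx0 [_ Ey] Uy]].
exists y; split => //=.
apply: trigint_lattice_ge0 => //; [exact: C_cut|exact: S_cut|] => j l.
have [|e e0 woff] := offA (y + (j%:R - l%:R) * (2 * pi / sigma)).
  by have := Ey (j%:Z - l%:Z); rewrite intrB.
exact: (trigint_off_support_ge0 e0 woff).
Qed.

End signed_transform.

(** * The essential support and the characteristic functions *)

Section completed_lebesgue.
Variable R : realType.
Local Notation leb := (@lebesgue_measure R).
Local Notation cleb := (@completed_lebesgue_measure R).
Local Notation cR := (caratheodory_type (wlength (@idfun R))^*%mu).

Lemma completed_measurable (A : set (measurableTypeR R)) :
  measurable A -> measurable (A : set cR).
Proof. exact: sub_caratheodory. Qed.

Lemma completed_measurable_id : measurable_fun setT (fun x : cR => x : R).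
Proof. by move=> _ Y mY; rewrite setTI; exact: completed_measurable. Qed.

Lemma not_ess_support (phi : R -> R) (x : R) : ~ ess_support phi x ->
  exists2 e : R, 0 < e &
    cleb (`]x - e, x + e[ `&` [set t | 0 < `|phi t|]) = 0%E.
Proof.
move=> /existsNP[e /not_implyP[e0 /negP]]; rewrite -leNgt => le0.
by exists e => //; apply/eqP; rewrite eq_le le0 measure_ge0.
Qed.

Lemma closed_ess_support (phi : R -> R) : closed (ess_support phi).
Proof.
rewrite -openC openE => x /not_ess_support [e e0 null].
exists (e / 2); first by rewrite /= divr_gt0.
move=> y; rewrite /ball/= => xy /(_ (e / 2)); rewrite divr_gt0// => /(_ isT).
apply/negP; rewrite -leNgt.
apply: (@le_trans _ _ (cleb (`]x - e, x + e[ `&` [set t | 0 < `|phi t|]))).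
  apply: le_outer_measure.
  apply: setSI; apply: subset_itvW;
    move: xy; rewrite ltr_norml => /andP[? ?]; lra.
by rewrite null.
Qed.

Lemma off_ess_support (phi : R -> R) (x : R) :
  measurable_fun setT (phi : cR -> R) -> ~ ess_support phi x ->
  exists2 e : R, 0 < e &
    {ae cleb, forall t, `|t - x| < e -> `|phi t| = 0}.
Proof.
move=> mphi /not_ess_support[e e0 null]; exists e => //.
exists (`]x - e, x + e[ `&` [set t | 0 < `|phi t|]); split => //.
  apply: measurableI.
    by apply: completed_measurable; exact: measurable_itv.
  rewrite (_ : [set t | _] =
      setT `&` (fun t : cR => `|phi t|) @^-1` `]0, +oo[%classic).
    by apply: measurableT_comp => //; exact: measurable_itv.
  by apply/seteqP; split => t /=; rewrite in_itv/= andbT; [split|case].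
move=> t /= /not_implyP[tx /eqP pt0]; split; last first.
  by rewrite lt_neqAle eq_sym pt0 normr_ge0.
rewrite in_itv/=; move: tx; rewrite ltr_norml => /andP[? ?].
by apply/andP; split; lra.
Qed.

End completed_lebesgue.

Section fourier_transforms.
Variable R : realType.
Local Notation cleb := (@completed_lebesgue_measure R).
Local Notation cR := (caratheodory_type (wlength (@idfun R))^*%mu).

(** The absolute value changes no integral, as phi >= 0 almost everywhere. *)
Lemma fourierE (phi : R -> R) (t : R) : is_density phi ->
  fourier phi t = (costr cleb (fun x : cR => x : R) (fun x : cR => `|phi x|) t
    -i* sintr cleb (fun x : cR => x : R) (fun x : cR => `|phi x|) t)%C.
Proof.
case=> /Lfun1_integrable iphi phi0 _.
have [mphi _] := (integrableP _ _ _ iphi).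
have {}mphi : measurable_fun setT (phi : cR -> R) by exact/measurable_EFinP.
have mid := @completed_measurable_id R.
have mX (h : R -> R) (s : R) : continuous h ->
    measurable_fun setT (fun x : cR => h (s * (x : R))).
  move=> ch; apply: (measurableT_comp (f := h)).
    exact: continuous_measurable_fun.
  exact: measurable_funM.
have aux (h : R -> R) (s : R) : continuous h ->
    \int[cleb]_x (h (s * (x : R)) * phi x) =
    \int[cleb]_x (`|phi x| * h (s * (x : R))).
  move=> ch; congr fine; apply: ae_eq_integral => //.
  - by apply/measurable_EFinP; apply: measurable_funM => //; exact: mX.
  - apply/measurable_EFinP; apply: measurable_funM; last exact: mX.
    exact: measurableT_comp.
  - have [N [mN N0 subN]] := phi0; exists N; split => // x /= neq.
    apply: subN => /= px; apply: neq => _.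
    by rewrite ger0_norm// mulrC.
rewrite /fourier /Cintegral; congr (_ +i* _)%C.
  rewrite /costr -aux; last exact: continuous_cos.
  apply: eq_Rintegral => x _; rewrite /= mulr0 subr0 cosN//.
rewrite -sintrN//; last exact: (integrable_norm iphi).
rewrite /sintr -(aux sin); last exact: continuous_sin.
by apply: eq_Rintegral => x _; rewrite /= mulr0 add0r mulNr.
Qed.

Lemma fourier_probE (mu : probability (measurableTypeR R) R) (t : R) :
  fourier_prob mu t =
  (costr mu idfun (fun=> 1) t -i* sintr mu idfun (fun=> 1) t)%C.
Proof.
rewrite /fourier_prob /Cintegral; congr (_ +i* _)%C.
  by apply: eq_Rintegral => x _ /=; rewrite cosN mul1r.
have mid : measurable_fun setT (idfun : measurableTypeR R -> R).
  exact: measurable_id.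
rewrite -(sintrN mid (fun=> ler01)
  (finite_measure_integrable_cst mu 1 measurableT)).
by apply: eq_Rintegral => x _ /=; rewrite mul1r mulNr.
Qed.

End fourier_transforms.

(** Extends the agreement of the transforms from t > sigma to t = sigma, an
endpoint at which the Fejer kernel concentrates. *)
Lemma continuous_cut (R : realType) (f : R -> R) (s : R) : continuous f ->
  (forall t, s < t -> f t = 0) -> forall t, s <= t -> f t = 0.
Proof.
move=> cf f0 t; rewrite le_eqVlt => /predU1P[<-|]; last exact: f0.
apply/eqP/negPn/negP => fs; have fs0 : 0 < `|f s| by rewrite normr_gt0.
have /cvgrPdist_lt/(_ _ fs0) [e /= e0 He] := cf s.
have : `|f s - f (s + e / 2)| < `|f s|.
  apply: He; rewrite /ball_/= opprD addNKr normrN gtr0_norm ?divr_gt0//.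
  by rewrite ltr_pdivrMr// ltr_pMr// ltr1n.
by rewrite (f0 (s + e / 2)) ?ltrDl ?divr_gt0// subr0 ltxx.
Qed.

Theorem corollary1p4 (R : realType) (sigma : R) (phi : R -> R)
    (f g : R -> R[i]) :
  0 < sigma ->
  is_density phi ->
  (forall t : R, f t = fourier phi t) ->
  is_char_fun g ->
  (forall t : R, U_ sigma t -> f t = g t) ->
  (@completed_lebesgue_measure R (ess_support phi) < (2 * pi / sigma)%:E)%E ->
  forall t : R, f t = g t.
Proof.
move=> s0 dphi fE [mu gE] fg Sphi t.
have [/Lfun1_integrable iphi _ nphi] := dphi.
have mphi : measurable_fun setT
    (phi : caratheodory_type (wlength (@idfun R))^*%mu -> R).
  by case/integrableP: iphi => /measurable_EFinP.
have iw1 := integrable_norm iphi.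
have iw2 := finite_measure_integrable_cst mu (1 : R) measurableT.
have mX1 := @completed_measurable_id R.
have mX2 : measurable_fun setT (idfun : measurableTypeR R -> R).
  exact: measurable_id.
pose X1 (x : caratheodory_type (wlength (@idfun R))^*%mu) : R := x.
pose w1 (x : caratheodory_type (wlength (@idfun R))^*%mu) : R := `|phi x|.
pose w2 (x : measurableTypeR R) : R := 1.
have w1_ge0 x : 0 <= w1 x by exact: normr_ge0.
have w2_ge0 x : 0 <= w2 x by exact: ler01.
pose C := fun t =>
  costr mu idfun w2 t - costr (@completed_lebesgue_measure R) X1 w1 t.
pose S := fun t =>
  sintr mu idfun w2 t - sintr (@completed_lebesgue_measure R) X1 w1 t.
have fgE s : C s = 0 -> S s = 0 -> f s = g s.
  move=> /subr0_eq C0 /subr0_eq S0.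
  by rewrite fE gE fourierE// fourier_probE C0 S0.
have fgC s : sigma < s -> C s = 0 /\ S s = 0.
  move=> ss; have := fg s; rewrite /U_ /= (lt_le_trans ss (ler_norm s)).
  rewrite fE gE fourierE// fourier_probE => /(_ isT) [c1 s1].
  by rewrite /C /S c1 (oppr_inj s1) !subrr.
have cC : continuous C.
  rewrite /C; apply: continuous_addf; first exact: continuous_costr.
  by apply: continuous_oppf; exact: continuous_costr.
have cS : continuous S.
  rewrite /S; apply: continuous_addf; first exact: continuous_sintr.
  by apply: continuous_oppf; exact: continuous_sintr.
have C_cut := continuous_cut cC (fun s ss => (fgC s ss).1).
have S_cut := continuous_cut cS (fun s ss => (fgC s ss).2).
(* Both measures have total mass 1. *)
have C0 : C 0 = 0.
  rewrite /C /costr.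
  under eq_Rintegral do rewrite mul0r cos0 mulr1.
  under [X in _ - X]eq_Rintegral do rewrite mul0r cos0 mulr1.
  rewrite Rintegral_cst// [X in fine X]probability_setT mul1r.
  by rewrite /Rintegral; move: nphi; rewrite Lnorm1 => /= ->; rewrite subrr.
have mA := closed_measurable (@closed_ess_support R phi).
have CS0 := small_support_transform_diff_eq0 mX1 w1_ge0 iw1 mX2 w2_ge0 iw2
  s0 C_cut S_cut mA Sphi (fun x => @off_ess_support R phi x mphi) C0.
have main s : 0 <= s -> C s = 0 /\ S s = 0.
  move=> s_ge0; have [ss|ss] := leP s sigma; first by apply: CS0; rewrite s_ge0.
  exact: fgC.
have [t0|t0] := leP 0 t; first by have [? ?] := main _ t0; exact: fgE.
have [|CN SN] := main (- t); first by rewrite oppr_ge0 ltW.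
apply: fgE.
  by rewrite -CN /C !costrN.
by rewrite -[RHS]oppr0 -SN /S !sintrN// opprB opprK addrC.
Qed.
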